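(* Let $(\mathcal{C}, \otimes, I)$ be a monoidal category and let $\mathcal{M}$ be a module category over $\mathcal{C}$. Assume that there is a pair of adjoint functors $\mathrm{Res} : \mathcal{C} \to \mathcal{M}$ and $\mathrm{Ind} : \mathcal{M} \to \mathcal{C}$ (with $\mathrm{Res}$ left adjoint to $\mathrm{Ind}$) such that both $\mathrm{Res}$ and $\mathrm{Ind}$ are module functors over $\mathcal{C}$, where $\mathcal{C}$ is viewed as a module category over itself. Assume further that $\mathrm{Ind}$ is exact and faithful. Then there is an algebra $A$ in $\mathcal{C}$ such that $\mathcal{M}$ is equivalent, as a category, to $\mathrm{Mod}_{\mathcal{C}}(A)$.
   Context: All categories are abelian over an algebraically closed field $k$, and all functors are additive. A monoidal category is a category $\mathcal{C}$ with a bifunctor $\otimes$, a unit object $I$, and natural associativity and unit isomorphisms satisfying the pentagon and triangle axioms. A module category over $\mathcal{C}$ is a category $\mathcal{M}$ with an exact bifunctor $\otimes : \mathcal{C}\times\mathcal{M}\to\mathcal{M}$, natural isomorphisms $m_{X,Y,M} : (X\otimes Y)\otimes M \to X\otimes(Y\otimes M)$ and $l_M : I\otimes M\to M$ ($X,Y\in\mathcal{C}$, $M\in\mathcal{M}$), satisfying the analogous pentagon and triangle axioms. The category $\mathcal{C}$ is a module category over itself via its own monoidal structure. A module functor between module categories $\mathcal{M}_1,\mathcal{M}_2$ over $\mathcal{C}$ is a functor $F:\mathcal{M}_1\to\mathcal{M}_2$ together with natural isomorphisms $c_{X,M}: F(X\otimes M)\to X\otimes F(M)$ such that $m_{X,Y,F(M)}\circ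 c_{X\otimes Y,M} = (\mathrm{id}_X\otimes c_{Y,M})\circ c_{X,Y\otimes M}\circ F(m_{X,Y,M})$ (up to the evident identification of both sides as maps $F((X\otimes Y)\otimes M)\to X\otimes(Y\otimes F(M))$) and $l_{F(M)}\circ c_{I,M} = F(l_M)$. An algebra in $\mathcal{C}$ is an object $A$ with morphisms $m:A\otimes A\to A$ and $e:I\to A$ satisfying associativity and unit axioms. A right $A$-module in $\mathcal{C}$ is an object $M\in\mathcal{C}$ with a morphism $a: M\otimes A\to M$ satisfying the associativity and unit axioms; $\mathrm{Mod}_{\mathcal{C}}(A)$ is the category of right $A$-modules in $\mathcal{C}$, with morphisms those morphisms of $\mathcal{C}$ that commute with the actions.
   Formalization: The adjunction is assumed to be one of module functors: its unit and counit are compatible with the module structures of Res and Ind. For merely adjoint functors with unrelated module structures the claim fails for some non-rigid C; for rigid C compatibility can be arranged. *)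

(* Defs.v *)
From HB Require Import structures.
From mathcomp Require Import all_boot ssralg.

Set Implicit Arguments.
Unset Strict Implicit.
Unset Printing Implicit Defensive.

Import GRing.Theory.
Local Open Scope ring_scope.

Local Obligation Tactic := idtac.

Declare Scope cat_scope.
Delimit Scope cat_scope with cat.

Record category := Category {
  ob :> Type;
  hom : ob -> ob -> Type;
  idm : forall X, hom X X;
  comp : forall X Y Z, hom Y Z -> hom X Y -> hom X Z;
  comp_idl : forall X Y (f : hom X Y), comp (idm Y) f = f;
  comp_idr : forall X Y (f : hom X Y), comp f (idm X) = f;
  comp_assoc : forall W X Y Z (h : hom Y Z) (g : hom X Y) (f : hom W X),
    comp h (comp g f) = comp (comp h g) f }.
Arguments hom {c} X Y.
Arguments idm {c} X.
Arguments comp {c X Y Z} g f.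

Notation "g ∘ f" := (comp g f) (at level 40, left associativity) : cat_scope.
Local Open Scope cat_scope.

Record iso (C : category) (X Y : C) := Iso {
  fwd :> hom X Y;
  bwd : hom Y X;
  fwdK : bwd ∘ fwd = idm X;
  bwdK : fwd ∘ bwd = idm Y }.

Record functor (C D : category) := Functor {
  fob :> C -> D;
  fmap : forall X Y : C, hom X Y -> hom (fob X) (fob Y);
  fmap_id : forall X, fmap (idm X) = idm (fob X);
  fmap_comp : forall X Y Z (g : hom Y Z) (f : hom X Y),
    fmap (g ∘ f) = fmap g ∘ fmap f }.
Arguments fmap {C D} F {X Y} f : rename.

Definition faithful (C D : category) (F : functor C D) : Prop :=
  forall (X Y : C) (f g : hom X Y), fmap F f = fmap F g -> f = g.

Record bifunctor (B C D : category) := Bifunctor {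
  bob :> B -> C -> D;
  bmap : forall (X X' : B) (Y Y' : C),
    hom X X' -> hom Y Y' -> hom (bob X Y) (bob X' Y');
  bmap_id : forall X Y, bmap (idm X) (idm Y) = idm (bob X Y);
  bmap_comp : forall X X' X'' Y Y' Y''
      (f' : hom X' X'') (f : hom X X') (g' : hom Y' Y'') (g : hom Y Y'),
    bmap (f' ∘ f) (g' ∘ g) = bmap f' g' ∘ bmap f g }.
Arguments bmap {B C D} T {X X' Y Y'} f g : rename.

Section PartialFunctors.
Variables (B C D : category) (T : bifunctor B C D).

Program Definition bifunctor_l (X : B) : functor C D :=
  @Functor C D (T X) (fun Y Y' g => bmap T (idm X) g) _ _.
Next Obligation. by move=> X Y /=; rewrite bmap_id. Qed.
Next Obligation. by move=> X Y Y' Y'' g f /=; rewrite -bmap_comp comp_idl. Qed.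

Program Definition bifunctor_r (Y : C) : functor B D :=
  @Functor B D (fun X => T X Y) (fun X X' f => bmap T f (idm Y)) _ _.
Next Obligation. by move=> Y X /=; rewrite bmap_id. Qed.
Next Obligation. by move=> Y X X' X'' g f /=; rewrite -bmap_comp comp_idl. Qed.

End PartialFunctors.

Definition functor_id (C : category) : functor C C :=
  @Functor C C id (fun _ _ f => f) (fun _ => erefl) (fun _ _ _ _ _ => erefl).

Program Definition functor_comp (C D E : category)
    (G : functor D E) (F : functor C D) : functor C E :=
  @Functor C E (fun X => G (F X)) (fun _ _ f => fmap G (fmap F f)) _ _.
Next Obligation. by move=> C D E G F X /=; rewrite !fmap_id. Qed.
Next Obligation. by move=> C D E G F X Y Z g f /=; rewrite !fmap_comp. Qed.

Record nat_iso (C D : category) (F G : functor C D) := NatIso {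
  ni_iso :> forall X : C, iso (F X) (G X);
  ni_natural : forall (X Y : C) (f : hom X Y),
    ni_iso Y ∘ fmap F f = fmap G f ∘ ni_iso X }.

Definition equivalent (C D : category) : Prop :=
  exists (F : functor C D) (G : functor D C),
    inhabited (nat_iso (functor_comp G F) (functor_id C)) /\
    inhabited (nat_iso (functor_comp F G) (functor_id D)).

Record adjunction (C D : category) (L : functor C D) (R : functor D C) :=
Adjunction {
  adj_unit : forall X : C, hom X (R (L X));
  adj_counit : forall M : D, hom (L (R M)) M;
  adj_unit_natural : forall (X Y : C) (f : hom X Y),
    adj_unit Y ∘ f = fmap R (fmap L f) ∘ adj_unit X;
  adj_counit_natural : forall (M N : D) (g : hom M N),
    adj_counit N ∘ fmap L (fmap R g) = g ∘ adj_counit M;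
  adj_triangle_l : forall X : C,
    adj_counit (L X) ∘ fmap L (adj_unit X) = idm (L X);
  adj_triangle_r : forall M : D,
    fmap R (adj_counit M) ∘ adj_unit (R M) = idm (R M) }.

Record linear_category (k : fieldType) := LinearCategory {
  lin_cat :> category;
  lin_hom : forall X Y : lin_cat, GRing.Lmodule k (hom X Y) }.

HB.instance Definition _ (k : fieldType) (C : linear_category k) (X Y : C) :=
  GRing.Lmodule.copy (hom X Y) (GRing.Lmodule.Pack (@lin_hom k C X Y)).

Definition bilinear_comp (k : fieldType) (C : linear_category k) : Prop :=
  (forall (X Y Z : C) (g : hom Y Z) (a : k) (f f' : hom X Y),
     g ∘ (a *: f + f') = a *: (g ∘ f) + g ∘ f') /\
  (forall (X Y Z : C) (f : hom X Y) (a : k) (g g' : hom Y Z),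
     (a *: g + g') ∘ f = a *: (g ∘ f) + g' ∘ f).

Section Abelian.
Variables (k : fieldType) (C : linear_category k).
Implicit Types X Y Z K Q P W : C.

Definition is_zero_object Z : Prop := idm Z = 0.

Definition is_biproduct X Y P (i1 : hom X P) (i2 : hom Y P)
    (p1 : hom P X) (p2 : hom P Y) : Prop :=
  [/\ p1 ∘ i1 = idm X, p2 ∘ i2 = idm Y, p1 ∘ i2 = 0, p2 ∘ i1 = 0
    & i1 ∘ p1 + i2 ∘ p2 = idm P].

Definition is_kernel X Y (f : hom X Y) K (i : hom K X) : Prop :=
  f ∘ i = 0 /\
  forall W (g : hom W X), f ∘ g = 0 -> exists! h : hom W K, i ∘ h = g.

Definition is_cokernel X Y (f : hom X Y) Q (p : hom Y Q) : Prop :=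
  p ∘ f = 0 /\
  forall W (g : hom Y W), g ∘ f = 0 -> exists! h : hom Q W, h ∘ p = g.

Definition mono X Y (f : hom X Y) : Prop :=
  forall W (g h : hom W X), f ∘ g = f ∘ h -> g = h.

Definition epi X Y (f : hom X Y) : Prop :=
  forall W (g h : hom Y W), g ∘ f = h ∘ f -> g = h.

Record is_abelian : Prop := IsAbelian {
  abelian_bilinear : bilinear_comp C;
  abelian_zero : exists Z, is_zero_object Z;
  abelian_biproduct : forall X Y, exists P
    (i1 : hom X P) (i2 : hom Y P) (p1 : hom P X) (p2 : hom P Y),
    is_biproduct i1 i2 p1 p2;
  abelian_kernel : forall X Y (f : hom X Y),
    exists K (i : hom K X), is_kernel f i;
  abelian_cokernel : forall X Y (f : hom X Y),
    exists Q (p : hom Y Q), is_cokernel f p;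
  abelian_mono : forall X Y (f : hom X Y), mono f ->
    exists Z (g : hom Y Z), is_kernel g f;
  abelian_epi : forall X Y (f : hom X Y), epi f ->
    exists Z (g : hom Z X), is_cokernel g f }.

Definition short_exact X Y Z (f : hom X Y) (g : hom Y Z) : Prop :=
  is_kernel g f /\ is_cokernel f g.

End Abelian.

Record abelian_category (k : fieldType) := AbelianCategory {
  ab_cat :> linear_category k;
  ab_abelian : is_abelian ab_cat }.

Section AdditiveFunctors.
Variable k : fieldType.

Definition is_additive (C D : linear_category k) (F : functor C D) : Prop :=
  forall (X Y : C) (f g : hom X Y), fmap F (f + g) = fmap F f + fmap F g.

Definition exact (C D : linear_category k) (F : functor C D) : Prop :=
  forall (X Y Z : C) (f : hom X Y) (g : hom Y Z),
    short_exact f g -> short_exact (fmap F f) (fmap F g).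

(** A bifunctor is additive (resp. exact) if it is so in each variable. *)
Definition biadditive (B C D : linear_category k) (T : bifunctor B C D) : Prop :=
  (forall X : B, is_additive (bifunctor_l T X)) /\
  (forall Y : C, is_additive (bifunctor_r T Y)).

Definition biexact (B C D : linear_category k) (T : bifunctor B C D) : Prop :=
  (forall X : B, exact (bifunctor_l T X)) /\
  (forall Y : C, exact (bifunctor_r T Y)).

End AdditiveFunctors.

Record monoidal_category (k : fieldType) := MonoidalCategory {
  mon_cat :> abelian_category k;
  tens : bifunctor mon_cat mon_cat mon_cat;
  tens_additive : biadditive tens;
  munit : mon_cat;
  massoc : forall X Y Z, iso (tens (tens X Y) Z) (tens X (tens Y Z));
  mlunit : forall X, iso (tens munit X) X;
  mrunit : forall X, iso (tens X munit) X;
  massoc_natural : forall X X' Y Y' Z Z'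
      (f : hom X X') (g : hom Y Y') (h : hom Z Z'),
    massoc X' Y' Z' ∘ bmap tens (bmap tens f g) h
    = bmap tens f (bmap tens g h) ∘ massoc X Y Z;
  mlunit_natural : forall X X' (f : hom X X'),
    mlunit X' ∘ bmap tens (idm munit) f = f ∘ mlunit X;
  mrunit_natural : forall X X' (f : hom X X'),
    mrunit X' ∘ bmap tens f (idm munit) = f ∘ mrunit X;
  mpentagon : forall W X Y Z,
    massoc W X (tens Y Z) ∘ massoc (tens W X) Y Z
    = bmap tens (idm W) (massoc X Y Z) ∘ massoc W (tens X Y) Z
        ∘ bmap tens (massoc W X Y) (idm Z);
  mtriangle : forall X Y,
    bmap tens (idm X) (mlunit Y) ∘ massoc X munit Y
    = bmap tens (mrunit X) (idm Y) }.
Arguments tens {k m}.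
Arguments munit {k m}.
Arguments massoc {k m} X Y Z.
Arguments mlunit {k m} X.
Arguments mrunit {k m} X.

Notation "X ⊗ Y" := (tens X Y) (at level 38, left associativity) : cat_scope.
Notation "f ⊗₁ g" := (bmap tens f g)
  (at level 38, left associativity) : cat_scope.
Notation "'𝟙'" := munit : cat_scope.

Record module_category (k : fieldType) (C : monoidal_category k) :=
ModuleCategory {
  mod_cat :> abelian_category k;
  act : bifunctor C mod_cat mod_cat;
  act_additive : biadditive act;
  act_exact : biexact act;
  aassoc : forall X Y M, iso (act (X ⊗ Y) M) (act X (act Y M));
  aunit : forall M, iso (act 𝟙 M) M;
  aassoc_natural : forall X X' Y Y' M M'
      (f : hom X X') (g : hom Y Y') (h : hom M M'),
    aassoc X' Y' M' ∘ bmap act (f ⊗₁ g) h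
    = bmap act f (bmap act g h) ∘ aassoc X Y M;
  aunit_natural : forall M M' (h : hom M M'),
    aunit M' ∘ bmap act (idm 𝟙) h = h ∘ aunit M;
  apentagon : forall X Y Z M,
    aassoc X Y (act Z M) ∘ aassoc (X ⊗ Y) Z M
    = bmap act (idm X) (aassoc Y Z M) ∘ aassoc X (Y ⊗ Z) M
        ∘ bmap act (massoc X Y Z) (idm M);
  atriangle : forall X M,
    bmap act (idm X) (aunit M) ∘ aassoc X 𝟙 M
    = bmap act (mrunit X) (idm M) }.
Arguments act {k C m}.
Arguments aassoc {k C m} X Y M : rename.
Arguments aunit {k C m} M : rename.

Notation "X ⊳ M" := (act X M) (at level 38, left associativity) : cat_scope.
Notation "f ⊳₁ g" := (bmap act f g)
  (at level 38, left associativity) : cat_scope.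

(** [C] as a module category over itself; since the action of a module category
    is exact by definition, this needs the tensor product to be exact. *)
Definition regular_module (k : fieldType) (C : monoidal_category k)
    (tens_exact : biexact (@tens k C)) : module_category C :=
  @ModuleCategory k C C tens (@tens_additive k C) tens_exact massoc mlunit
    (@massoc_natural k C) (@mlunit_natural k C)
    (@mpentagon k C) (@mtriangle k C).

Record module_functor (k : fieldType) (C : monoidal_category k)
    (M1 M2 : module_category C) := ModuleFunctor {
  mf_functor :> functor M1 M2;
  mf_additive : is_additive mf_functor;
  mf_iso : forall (X : C) (M : M1), iso (mf_functor (X ⊳ M)) (X ⊳ mf_functor M);
  mf_natural : forall (X X' : C) (M M' : M1) (f : hom X X') (g : hom M M'),
    mf_iso X' M' ∘ fmap mf_functor (f ⊳₁ g)
    = (f ⊳₁ fmap mf_functor g) ∘ mf_iso X M;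
  mf_assoc : forall (X Y : C) (M : M1),
    aassoc X Y (mf_functor M) ∘ mf_iso (X ⊗ Y) M
    = (idm X ⊳₁ mf_iso Y M) ∘ mf_iso X (Y ⊳ M)
        ∘ fmap mf_functor (aassoc X Y M);
  mf_unit : forall M : M1,
    aunit (mf_functor M) ∘ mf_iso 𝟙 M = fmap mf_functor (aunit M) }.
Arguments mf_iso {k C M1 M2} F X M : rename.

(** The unit and the counit are morphisms of module functors, i.e. [L] and [R]
    are adjoint as module functors and not merely as functors. The module
    structure of the composite [R L] is [mf_iso R X (L M) ∘ R (mf_iso L X M)]. *)
Definition module_adjunction (k : fieldType) (C : monoidal_category k)
    (M1 M2 : module_category C) (L : module_functor M1 M2)
    (R : module_functor M2 M1) (adj : adjunction L R) : Prop :=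
  (forall (X : C) (M : M1),
     mf_iso R X (L M) ∘ fmap R (mf_iso L X M) ∘ adj_unit adj (X ⊳ M)
     = idm X ⊳₁ adj_unit adj M) /\
  (forall (X : C) (N : M2),
     (idm X ⊳₁ adj_counit adj N) ∘ (mf_iso L X (R N) ∘ fmap L (mf_iso R X N))
     = adj_counit adj (X ⊳ N)).

Record algebra (k : fieldType) (C : monoidal_category k) := Algebra {
  alg_ob :> C;
  alg_mul : hom (alg_ob ⊗ alg_ob) alg_ob;
  alg_unit : hom 𝟙 alg_ob;
  alg_assoc :
    alg_mul ∘ (alg_mul ⊗₁ idm alg_ob)
    = alg_mul ∘ (idm alg_ob ⊗₁ alg_mul) ∘ massoc alg_ob alg_ob alg_ob;
  alg_unitl : alg_mul ∘ (alg_unit ⊗₁ idm alg_ob) = mlunit alg_ob;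
  alg_unitr : alg_mul ∘ (idm alg_ob ⊗₁ alg_unit) = mrunit alg_ob }.
Arguments alg_mul {k C} A : rename.
Arguments alg_unit {k C} A : rename.

Section ModulesOverAlgebra.
Variables (k : fieldType) (C : monoidal_category k) (A : algebra C).

Record right_module := RightModule {
  rm_ob :> C;
  rm_act : hom (rm_ob ⊗ A) rm_ob;
  rm_assoc :
    rm_act ∘ (rm_act ⊗₁ idm (A : C))
    = rm_act ∘ (idm rm_ob ⊗₁ alg_mul A) ∘ massoc rm_ob A A;
  rm_unit : rm_act ∘ (idm rm_ob ⊗₁ alg_unit A) = mrunit rm_ob }.

Definition rm_hom (M N : right_module) : Type :=
  {f : hom (M : C) (N : C) | f ∘ rm_act M == rm_act N ∘ (f ⊗₁ idm (A : C))}.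

Program Definition rm_id (M : right_module) : rm_hom M M :=
  exist _ (idm (M : C)) _.
Next Obligation. by move=> M /=; rewrite bmap_id comp_idl comp_idr. Qed.

Program Definition rm_comp (M N P : right_module)
    (g : rm_hom N P) (f : rm_hom M N) : rm_hom M P :=
  exist _ (val g ∘ val f) _.
Next Obligation.
move=> M N P [g /= /eqP gP] [f /= /eqP fP]; apply/eqP.
rewrite -[idm (A : C)](comp_idl (idm (A : C))) bmap_comp.
by rewrite comp_assoc -gP -!comp_assoc fP.
Qed.

Program Definition Mod : category :=
  @Category right_module rm_hom rm_id rm_comp _ _ _.
Next Obligation. by move=> M N f; apply: val_inj; rewrite /= comp_idl. Qed.
Next Obligation. by move=> M N f; apply: val_inj; rewrite /= comp_idr. Qed.
Next Obligation. by move=> M N P Q h g f; apply: val_inj; rewrite /= comp_assoc. Qed.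

End ModulesOverAlgebra.

(* Main.v *)
From mathcomp Require Import all_boot ssralg.
From Stdlib Require Import ClassicalEpsilon.
Require Import Defs.

Set Implicit Arguments.
Unset Strict Implicit.
Unset Printing Implicit Defensive.

(** The algebra is [A = Ind (Res 𝟙)], and the equivalence sends an object [N] of
    [M] to [Ind N] with the action of [A] induced by the counit
    [ε : Res Ind N -> N].

    Two independent ideas carry the proof. The first is that the monad
    [T = Ind Res] on [C] is determined by its value at [𝟙]: the module
    structures of [Res] and [Ind] combine into natural isomorphisms
    [T (X ⊗ Y) ≅ X ⊗ T Y], whence [T X ≅ T (X ⊗ 𝟙) ≅ X ⊗ A]. As the unit and the
    counit of the adjunction respect the module structures, these isomorphisms
    respect the unit and the multiplication of [T] ([as_tensor_ret],
    [as_tensor_join]); the multiplication of [T] thus becomes one of [A], and a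
    [T]-algebra is the same thing as a right [A]-module ([module_algebraP]).
    That [A] is an algebra is an instance of this, because [T 𝟙] is a free
    [T]-algebra; only the left unit law is separate, and it is there that the
    equality of the two unit isomorphisms of [𝟙 ⊗ 𝟙] is used.

    The second is a form of the Barr-Beck theorem: a right adjoint between
    abelian categories that is additive, exact and faithful is monadic. As [R]
    is faithful, the counits are epimorphisms, hence cokernels, so that a map of
    [T]-algebras [R N -> R N'] descends to a map [N -> N']
    ([algebra_map_lift]). A [T]-algebra [a : T X -> X] comes from the cokernel
    [Q] of [L a - ε : L R L X -> L X]: exactness makes [R Q] the cokernel of
    [T a - R ε], and [a] itself is a cokernel of that map, by the split fork
    that every algebra carries ([algebra_of_object]).

    So the functor from [M] to right [A]-modules is fully faithful and
    essentially surjective. *)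

Import GRing.Theory.
Local Open Scope ring_scope.
Local Open Scope cat_scope.

(** * Equivalences of categories *)

Definition full (C D : category) (F : functor C D) : Prop :=
  forall (X Y : C) (f : hom (F X) (F Y)), exists g : hom X Y, fmap F g = f.

Definition essentially_surjective (C D : category) (F : functor C D) : Prop :=
  forall Y : D, exists X : C, inhabited (iso (F X) Y).

Definition iso_sym (C : category) (X Y : C) (f : iso X Y) : iso Y X :=
  Iso (bwdK f) (fwdK f).

Definition fmap_iso (C D : category) (F : functor C D) (X Y : C)
    (f : iso X Y) : iso (F X) (F Y).
Proof.
exists (fmap F f) (fmap F (bwd f)).
- by rewrite -fmap_comp fwdK fmap_id.
- by rewrite -fmap_comp bwdK fmap_id.
Defined.

Definition iso_comp (C : category) (X Y Z : C) (g : iso Y Z) (f : iso X Y) :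
  iso X Z.
Proof.
exists (fwd g ∘ f) (bwd f ∘ bwd g).
- by rewrite comp_assoc -(comp_assoc (bwd f)) fwdK comp_idr fwdK.
- by rewrite comp_assoc -(comp_assoc (fwd g)) bwdK comp_idr bwdK.
Defined.

Lemma iso_cancel_l (C : category) (X Y W : C) (f : iso X Y) (u v : hom W X) :
  fwd f ∘ u = fwd f ∘ v -> u = v.
Proof.
by move=> /(congr1 (comp (bwd f))); rewrite !comp_assoc fwdK !comp_idl.
Qed.

Lemma iso_cancel_r (C : category) (X Y W : C) (f : iso X Y) (u v : hom Y W) :
  u ∘ fwd f = v ∘ fwd f -> u = v.
Proof.
move=> /(congr1 (fun w => w ∘ bwd f)).
by rewrite -!comp_assoc bwdK !comp_idr.
Qed.

Lemma comp_fwdK (C : category) (X Y W : C) (f : iso X Y) (u : hom X W) :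
  u ∘ bwd f ∘ fwd f = u.
Proof. by rewrite -comp_assoc fwdK comp_idr. Qed.

Lemma comp_bwdK (C : category) (X Y W : C) (f : iso X Y) (u : hom Y W) :
  u ∘ fwd f ∘ bwd f = u.
Proof. by rewrite -comp_assoc bwdK comp_idr. Qed.

Section FullyFaithful.
Variables (C D : category) (F : functor C D).
Hypotheses (F_full : full F) (F_faithful : faithful F)
  (F_surj : essentially_surjective F).

(** The quasi-inverse is a choice of preimages of objects and of morphisms;
    functoriality follows from faithfulness. *)
Definition preimage (X Y : C) (f : hom (F X) (F Y)) : hom X Y :=
  sval (constructive_indefinite_description _ (F_full f)).

Lemma preimageK (X Y : C) (f : hom (F X) (F Y)) : fmap F (preimage f) = f.
Proof. exact: (svalP (constructive_indefinite_description _ (F_full f))). Qed.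

Definition qinv_ob (Y : D) : C :=
  sval (constructive_indefinite_description _ (F_surj Y)).

Definition qinv_iso (Y : D) : iso (F (qinv_ob Y)) Y :=
  epsilon (svalP (constructive_indefinite_description _ (F_surj Y)))
    (fun _ => True).

Definition qinv_map (Y Z : D) (g : hom Y Z) : hom (qinv_ob Y) (qinv_ob Z) :=
  preimage (bwd (qinv_iso Z) ∘ g ∘ qinv_iso Y).

Definition quasi_inverse : functor D C.
Proof.
apply: (@Functor D C qinv_ob qinv_map) => [Y|X Y Z g f]; apply: F_faithful.
  by rewrite preimageK fmap_id comp_idr fwdK.
by rewrite fmap_comp !preimageK !comp_assoc comp_bwdK.
Defined.

(** Fully faithful functors reflect isomorphisms: the preimages of two inverse
    morphisms are inverse by faithfulness. *)
Lemma iso_of_image (X Y : C) (f : iso (F X) (F Y)) :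
  {g : iso X Y | fmap F g = f}.
Proof.
have gK : preimage (bwd f) ∘ preimage f = idm X.
  by apply: F_faithful; rewrite fmap_comp !preimageK fwdK fmap_id.
have Kg : preimage f ∘ preimage (bwd f) = idm Y.
  by apply: F_faithful; rewrite fmap_comp !preimageK bwdK fmap_id.
by exists (Iso gK Kg); rewrite preimageK.
Qed.

Lemma fully_faithful_equivalent : equivalent C D.
Proof.
exists F, quasi_inverse; split; constructor.
- pose u X := iso_of_image (qinv_iso (F X)).
  exists (fun X => sval (u X)) => X Y f /=; apply: F_faithful.
  rewrite !fmap_comp (svalP (u X)) (svalP (u Y)) preimageK.
  by rewrite !comp_assoc bwdK comp_idl.
- exists qinv_iso => X Y f /=.
  by rewrite preimageK !comp_assoc bwdK comp_idl.
Qed.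

End FullyFaithful.

(** * Exact functors between abelian categories *)

Section Abelian.
Variables (k : fieldType) (C : abelian_category k).
Implicit Types X Y Z K Q W : C.

Lemma comprDr X Y Z (g : hom Y Z) (f f' : hom X Y) :
  g ∘ (f + f') = g ∘ f + g ∘ f'.
Proof.
have [/(_ X Y Z g 1 f f') + _] := abelian_bilinear (ab_abelian C).
by rewrite !scale1r.
Qed.

Lemma comprDl X Y Z (f : hom X Y) (g g' : hom Y Z) :
  (g + g') ∘ f = g ∘ f + g' ∘ f.
Proof.
have [_ /(_ X Y Z f 1 g g')] := abelian_bilinear (ab_abelian C).
by rewrite !scale1r.
Qed.

Lemma compr0 X Y Z (g : hom Y Z) : g ∘ (0 : hom X Y) = 0.
Proof. by apply: (@addIr _ (g ∘ (0 : hom X Y))); rewrite -comprDr !add0r. Qed.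

Lemma comp0r X Y Z (f : hom X Y) : (0 : hom Y Z) ∘ f = 0.
Proof. by apply: (@addIr _ ((0 : hom Y Z) ∘ f)); rewrite -comprDl !add0r. Qed.

Lemma comprBr X Y Z (g : hom Y Z) (f f' : hom X Y) :
  g ∘ (f - f') = g ∘ f - g ∘ f'.
Proof. by apply: (@addIr _ (g ∘ f')); rewrite -comprDr !subrK. Qed.

Lemma comprBl X Y Z (f : hom X Y) (g g' : hom Y Z) :
  (g - g') ∘ f = g ∘ f - g' ∘ f.
Proof. by apply: (@addIr _ (g' ∘ f)); rewrite -comprDl !subrK. Qed.

Lemma kernel_mono X Y K (f : hom X Y) (i : hom K X) : is_kernel f i -> mono i.
Proof.
move=> [fi0 ker] W g h igh.
have [|w [_ w_uniq]] := ker W (i ∘ g); first by rewrite comp_assoc fi0 comp0r.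
by rewrite -(w_uniq g) // -(w_uniq h).
Qed.

Lemma cokernel_epi X Y Q (f : hom X Y) (p : hom Y Q) : is_cokernel f p -> epi p.
Proof.
move=> [pf0 coker] W g h gph.
have [|w [_ w_uniq]] := coker W (g ∘ p); first by rewrite -comp_assoc pf0 compr0.
by rewrite -(w_uniq g) // -(w_uniq h).
Qed.

Lemma epi_of_zero X Y (f : hom X Y) :
  (forall W (g : hom Y W), g ∘ f = 0 -> g = 0) -> epi f.
Proof.
move=> f0 W g h gfh; apply/subr0_eq/f0.
by rewrite comprBl gfh subrr.
Qed.

Lemma cokernel_of_kernel X Y K Q (f : hom X Y) (p : hom Y Q) (i : hom K Y) :
  is_cokernel f p -> is_kernel p i -> is_cokernel i p.
Proof.
move=> [pf0 coker] [pi0 ker]; split=> // W g gi0; apply: coker.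
have [e [ie _]] := ker _ f pf0.
by rewrite -ie comp_assoc gi0 comp0r.
Qed.

(** In an abelian category the first factor of the image factorization is epi.
    If [h ∘ e = 0], then [e] factors through [m = ker h]. The monomorphism
    [i ∘ m] is the kernel of some [t], and [t] kills [f], hence factors through
    its cokernel [p] and kills [i]. So [i] factors through [i ∘ m], which makes
    [m] split epi and forces [h = 0]. *)
Lemma image_epi X Y K Q (f : hom X Y) (p : hom Y Q) (i : hom K Y) (e : hom X K) :
  is_cokernel f p -> is_kernel p i -> i ∘ e = f -> epi e.
Proof.
move=> [pf0 coker] pi ie; apply: epi_of_zero => W h he0.
have [K' [m hm]] := abelian_kernel (ab_abelian C) h.
have [e' [me' _]] := hm.2 _ e he0.
have im_mono : mono (i ∘ m).
  move=> V u v; rewrite -!comp_assoc => /(kernel_mono pi).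
  exact: kernel_mono hm _ _ _.
have [Z [t [tim tker]]] := abelian_mono (ab_abelian C) im_mono.
have [|t' [t'p _]] := coker _ t.
  by rewrite -ie -me' (comp_assoc i) comp_assoc tim comp0r.
have [|s [ims _]] := tker _ i; first by rewrite -t'p -comp_assoc pi.1 compr0.
have ms : m ∘ s = idm K.
  by apply: (kernel_mono pi); rewrite comp_assoc ims comp_idr.
by rewrite -[h]comp_idr -ms comp_assoc hm.1 comp0r.
Qed.

End Abelian.

Section ExactFunctor.
Variables (k : fieldType) (C D : abelian_category k) (F : functor C D).
Hypothesis F_exact : exact F.

Lemma exact_cokernel_of_kernel (X Y K Q : C) (f : hom X Y) (p : hom Y Q)
    (i : hom K Y) :
  is_cokernel f p -> is_kernel p i -> is_cokernel (fmap F i) (fmap F p).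
Proof.
by move=> fp pi; have [] := F_exact (conj pi (cokernel_of_kernel fp pi)).
Qed.

(** An epimorphism is the cokernel of its kernel, hence ends a short exact
    sequence. *)
Lemma exact_epi (X Y : C) (f : hom X Y) : epi f -> epi (fmap F f).
Proof.
move=> /(abelian_epi (ab_abelian C))[Z [g gf]].
have [K [i fi]] := abelian_kernel (ab_abelian C) f.
exact: cokernel_epi (exact_cokernel_of_kernel gf fi).
Qed.

(** Exactness speaks of short exact sequences only, whereas [f] need not be
    mono: it is replaced by its image [i], which has the same cokernel, and
    [F f] and [F i] have the same cokernel because they differ by an
    epimorphism. *)
Lemma exact_cokernel (X Y Q : C) (f : hom X Y) (p : hom Y Q) :
  is_cokernel f p -> is_cokernel (fmap F f) (fmap F p).
Proof.
move=> fp; have [K [i pi]] := abelian_kernel (ab_abelian C) p.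
have [e [ie _]] := pi.2 _ f fp.1.
have [Fpi0 coker] := exact_cokernel_of_kernel fp pi.
split=> [|W g gf0].
  by rewrite -ie fmap_comp comp_assoc Fpi0 comp0r.
apply: coker; apply: (exact_epi (image_epi fp pi ie)).
by rewrite -comp_assoc -fmap_comp ie gf0 comp0r.
Qed.

End ExactFunctor.

(** * Monads and monadicity *)

Record monad (C : category) := Monad {
  mnd :> functor C C;
  ret : forall X, hom X (mnd X);
  join : forall X, hom (mnd (mnd X)) (mnd X);
  ret_natural : forall X Y (f : hom X Y), ret Y ∘ f = fmap mnd f ∘ ret X;
  join_natural : forall X Y (f : hom X Y),
    join Y ∘ fmap mnd (fmap mnd f) = fmap mnd f ∘ join X;
  join_ret : forall X, join X ∘ ret (mnd X) = idm (mnd X);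
  join_fmap_ret : forall X, join X ∘ fmap mnd (ret X) = idm (mnd X);
  join_assoc : forall X, join X ∘ fmap mnd (join X) = join X ∘ join (mnd X) }.
Arguments ret {C} T X : rename.
Arguments join {C} T X : rename.

Definition monad_algebra (C : category) (T : monad C) (X : C)
    (a : hom (T X) X) : Prop :=
  a ∘ ret T X = idm X /\ a ∘ fmap T a = a ∘ join T X.

Lemma free_algebra (C : category) (T : monad C) (X : C) :
  monad_algebra (join T X).
Proof. by split; [exact: join_ret | exact: join_assoc]. Qed.

Section AdjunctionMonad.
Variables (C D : category) (L : functor C D) (R : functor D C).
Variable adj : adjunction L R.
Local Notation η := (adj_unit adj).
Local Notation ε := (adj_counit adj).

Definition adj_monad : monad C.
Proof.
apply: (@Monad C (functor_comp R L) η (fun X => fmap R (ε (L X)))) => /=.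
- exact: adj_unit_natural.
- by move=> X Y f; rewrite -!fmap_comp adj_counit_natural.
- by move=> X; rewrite adj_triangle_r.
- by move=> X; rewrite -fmap_comp adj_triangle_l fmap_id.
- by move=> X; rewrite -!fmap_comp adj_counit_natural.
Defined.

(** The comparison functor from [D] to algebras over the monad, on objects. *)
Lemma counit_algebra (N : D) :
  @monad_algebra C adj_monad (R N) (fmap R (ε N)).
Proof.
by split=> /=; rewrite ?adj_triangle_r // -!fmap_comp adj_counit_natural.
Qed.

End AdjunctionMonad.

Section Monadicity.
Variables (k : fieldType) (C D : abelian_category k).
Variables (L : functor C D) (R : functor D C) (adj : adjunction L R).
Hypothesis R_additive : is_additive (R : functor D C).
Local Notation η := (adj_unit adj).
Local Notation ε := (adj_counit adj).
Local Notation T := (adj_monad adj).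

(** [R] turns the counit into a split epimorphism, by a triangle identity, and
    faithful functors reflect epimorphisms. *)
Lemma counit_epi (N : D) : faithful R -> epi (ε N).
Proof.
move=> R_faithful W g h /(congr1 (fun u => fmap R u ∘ η (R N))).
rewrite !fmap_comp -!comp_assoc adj_triangle_r !comp_idr.
exact: R_faithful.
Qed.

Lemma additive_fmap0 (X Y : D) : fmap R (0 : hom X Y) = 0.
Proof.
by apply: (@addIr _ (fmap R (0 : hom X Y))); rewrite -R_additive !add0r.
Qed.

Lemma additive_fmapB (X Y : D) (f g : hom X Y) :
  fmap R (f - g) = fmap R f - fmap R g.
Proof. by apply: (@addIr _ (fmap R g)); rewrite -R_additive !subrK. Qed.

(** Fullness of the comparison functor. The transpose [ε N' ∘ L f] of [f]
    factors through the cokernel [ε N] because it kills the map [z] of which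
    [ε N] is a cokernel; after applying the faithful functor [R] this is the
    assumption that [f] is a map of algebras. *)
Lemma algebra_map_lift (R_faithful : faithful R) (N N' : D)
    (f : hom (R N) (R N')) :
  f ∘ fmap R (ε N) = fmap R (ε N') ∘ fmap T f ->
  exists g : hom N N', fmap R g = f.
Proof.
move=> fT.
have [Z [z [εz coker]]] :=
  abelian_epi (ab_abelian D) (counit_epi (N := N) R_faithful).
have [|g [gε _]] := coker _ (ε N' ∘ fmap L f).
  apply: R_faithful; rewrite !fmap_comp -fT -comp_assoc -fmap_comp εz.
  by rewrite !additive_fmap0 compr0.
exists g; rewrite -[LHS]comp_idr -(adj_triangle_r adj) comp_assoc -fmap_comp gε.
by rewrite fmap_comp -fT -comp_assoc adj_triangle_r comp_idr.
Qed.

(** Essential surjectivity of the comparison functor. With [q] the cokernel of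
    [L a - ε], both [R q] and [a] are cokernels of [T a - R ε]: the former by
    exactness, the latter because [η] splits the fork
    [R L R L X ⇉ R L X -> X]. *)
Lemma algebra_of_object (R_exact : exact R) (X : C) (a : hom (T X) X) :
  monad_algebra a ->
  exists (Q : D) (θ : iso X (R Q)), θ ∘ a = fmap R (ε Q) ∘ fmap T θ.
Proof.
move=> [aη aT].
have [Q [q coker_q]] :=
  abelian_cokernel (ab_abelian D) (fmap L a - ε (L X)).
have [] := exact_cokernel R_exact coker_q.
rewrite additive_fmapB => Rq0 Rcoker.
have RqT : fmap R q ∘ fmap R (fmap L a) = fmap R q ∘ fmap R (ε (L X)).
  by apply: subr0_eq; rewrite -comprBr.
have [|θ' [θ'q _]] := Rcoker _ a; first by rewrite comprBr [X in X - _]aT subrr.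
(* the comparison of the two cokernels, read off the splitting [η X] of [a] *)
pose θ := fmap R q ∘ η X.
have θa : θ ∘ a = fmap R q.
  rewrite -comp_assoc adj_unit_natural comp_assoc RqT -comp_assoc.
  by rewrite [X in _ ∘ X](adj_triangle_r adj) comp_idr.
have Kθ : θ' ∘ θ = idm X by rewrite comp_assoc θ'q.
have θK : θ ∘ θ' = idm (R Q).
  apply: (exact_epi R_exact (cokernel_epi coker_q)).
  by rewrite -comp_assoc θ'q θa comp_idl.
exists Q, (Iso Kθ θK).
rewrite θa /θ /= !fmap_comp comp_assoc -fmap_comp adj_counit_natural fmap_comp.
by rewrite -comp_assoc -fmap_comp adj_triangle_l fmap_id comp_idr.
Qed.

End Monadicity.

(** * Coherence of the unit of a monoidal category *)

Section Kelly.
Variables (k : fieldType) (C : monoidal_category k).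
Implicit Types X Y Z : C.

Lemma tens_compl X Y Z W (g : hom Y Z) (f : hom X Y) :
  (g ∘ f) ⊗₁ idm W = (g ⊗₁ idm W) ∘ (f ⊗₁ idm W).
Proof. by rewrite -bmap_comp comp_idl. Qed.

Lemma tens_compr X Y Z W (g : hom Y Z) (f : hom X Y) :
  idm W ⊗₁ (g ∘ f) = (idm W ⊗₁ g) ∘ (idm W ⊗₁ f).
Proof. by rewrite -bmap_comp comp_idl. Qed.

(** Tensoring with the unit is isomorphic to the identity functor. *)
Lemma tens_unitr_faithful X Y (f g : hom X Y) :
  f ⊗₁ idm 𝟙 = g ⊗₁ idm 𝟙 -> f = g.
Proof.
move=> fg; apply: (iso_cancel_r (f := mrunit X)).
by rewrite -!mrunit_natural fg.
Qed.

Lemma tens_unitl_faithful X Y (f g : hom X Y) :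
  idm 𝟙 ⊗₁ f = idm 𝟙 ⊗₁ g -> f = g.
Proof.
move=> fg; apply: (iso_cancel_r (f := mlunit X)).
by rewrite -!mlunit_natural fg.
Qed.

(** Kelly's coherence result that the pentagon and the triangle imply the
    triangle with the unit at the right end: after tensoring with [𝟙] on the
    right it is the pentagon for [X, Y, 𝟙, 𝟙] followed by the left unit of the
    last [𝟙], all unit isomorphisms being removed by the triangle. *)
Lemma mrunit_tens X Y :
  fwd (mrunit (X ⊗ Y)) = (idm X ⊗₁ mrunit Y) ∘ massoc X Y 𝟙.
Proof.
apply: tens_unitr_faithful; apply: (iso_cancel_l (f := massoc X Y 𝟙)).
rewrite tens_compl comp_assoc massoc_natural.
rewrite -(mtriangle Y) tens_compr -!comp_assoc.
rewrite (comp_assoc (idm X ⊗₁ fwd (massoc Y 𝟙 𝟙))).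
rewrite -mpentagon comp_assoc -massoc_natural -comp_assoc.
by rewrite bmap_id mtriangle.
Qed.

(** Both isomorphisms become equal after tensoring with [𝟙] on the left: by the
    triangle and [mrunit_tens] this amounts to [mrunit 𝟙 ⊗ 𝟙] and
    [mrunit (𝟙 ⊗ 𝟙)] being equal, which is naturality of [mrunit] at
    [mrunit 𝟙]. *)
Lemma mlunit_unit : fwd (mlunit 𝟙) = mrunit (𝟙 : C).
Proof.
apply: tens_unitl_faithful; apply: (iso_cancel_r (f := massoc 𝟙 𝟙 𝟙)).
rewrite mtriangle -mrunit_tens.
by apply: (iso_cancel_l (f := mrunit 𝟙)); rewrite mrunit_natural.
Qed.

End Kelly.

(** * Linear monads on a monoidal category *)

(** A monad in the 2-category of [C]-modules on [C] itself: [T] is a module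
    functor through [str], and its unit and multiplication are module
    transformations. *)
Record tensor_monad (k : fieldType) (C : monoidal_category k) (T : monad C) :=
TensorMonad {
  str : forall X Y : C, iso (T (X ⊗ Y)) (X ⊗ T Y);
  str_natural : forall (X X' Y Y' : C) (f : hom X X') (g : hom Y Y'),
    str X' Y' ∘ fmap T (f ⊗₁ g) = (f ⊗₁ fmap T g) ∘ str X Y;
  str_assoc : forall X Y Z : C,
    massoc X Y (T Z) ∘ str (X ⊗ Y) Z
    = (idm X ⊗₁ str Y Z) ∘ str X (Y ⊗ Z) ∘ fmap T (massoc X Y Z);
  str_unit : forall X : C, mlunit (T X) ∘ str 𝟙 X = fmap T (mlunit X);
  str_ret : forall X Y : C, str X Y ∘ ret T (X ⊗ Y) = idm X ⊗₁ ret T Y;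
  str_join : forall X Y : C,
    str X Y ∘ join T (X ⊗ Y)
    = (idm X ⊗₁ join T Y) ∘ str X (T Y) ∘ fmap T (str X Y) }.
Arguments str {k C T} S X Y : rename.

Section TensorMonad.
Variables (k : fieldType) (C : monoidal_category k) (T : monad C).
Variable S : tensor_monad T.
Implicit Types X Y : C.

Local Notation A := (T 𝟙).

(** Module endofunctors of [C] are determined by their value at [𝟙]. *)
Definition as_tensor X : iso (T X) (X ⊗ A) :=
  iso_comp (str S X 𝟙) (fmap_iso T (iso_sym (mrunit X))).
Local Notation φ := as_tensor.

Lemma as_tensor_natural X Y (f : hom X Y) :
  φ Y ∘ fmap T f = (f ⊗₁ idm A) ∘ φ X.
Proof.
rewrite /= -comp_assoc -fmap_comp.
have -> : bwd (mrunit Y) ∘ f = (f ⊗₁ idm 𝟙) ∘ bwd (mrunit X).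
  apply: (iso_cancel_l (f := mrunit Y)).
  by rewrite !comp_assoc bwdK comp_idl mrunit_natural comp_bwdK.
by rewrite fmap_comp !comp_assoc str_natural fmap_id.
Qed.

Lemma as_tensor_ret X :
  φ X ∘ ret T X = (idm X ⊗₁ ret T 𝟙) ∘ bwd (mrunit X).
Proof. by rewrite /= -comp_assoc -ret_natural comp_assoc str_ret. Qed.

(** Under [as_tensor] the isomorphism [str] is the associativity. *)
Lemma as_tensor_tens X Y :
  massoc X Y A ∘ φ (X ⊗ Y) = (idm X ⊗₁ φ Y) ∘ str S X Y.
Proof.
rewrite /= comp_assoc str_assoc -comp_assoc -fmap_comp tens_compr.
have -> : massoc X Y 𝟙 ∘ bwd (mrunit (X ⊗ Y)) = idm X ⊗₁ bwd (mrunit Y).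
  apply: (iso_cancel_r (f := mrunit (X ⊗ Y))).
  rewrite comp_fwdK mrunit_tens comp_assoc -tens_compr fwdK bmap_id.
  by rewrite comp_idl.
by rewrite -!comp_assoc str_natural.
Qed.

(** The isomorphism [T 𝟙 ≅ 𝟙 ⊗ T 𝟙] is built from the right unit of [𝟙], whereas
    [str_unit] concerns the left one; they agree by [mlunit_unit]. *)
Lemma as_tensor_unit : mlunit A ∘ φ 𝟙 = idm A.
Proof.
by rewrite /= comp_assoc str_unit -fmap_comp mlunit_unit bwdK fmap_id.
Qed.

Definition tmul : hom (A ⊗ A) A := join T 𝟙 ∘ bwd (φ A).

(** Through [as_tensor], the multiplication of [T] at [X] is [X] tensored with
    that of [A]: [str_join] reduces the multiplication at [X ≅ X ⊗ 𝟙] to the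
    one at [𝟙]. *)
Lemma as_tensor_join X :
  φ X ∘ join T X
  = (idm X ⊗₁ tmul) ∘ massoc X A A ∘ (φ X ⊗₁ idm A) ∘ φ (T X).
Proof.
rewrite -[RHS]comp_assoc -as_tensor_natural comp_assoc.
rewrite -(comp_assoc _ (fwd (massoc _ _ _))) as_tensor_tens comp_assoc.
rewrite -tens_compr /tmul comp_fwdK /= fmap_comp !comp_assoc -str_join.
by rewrite -!comp_assoc -join_natural.
Qed.

(** Both associativity laws have the same shape once precomposed with the
    isomorphism [χ : T T X ≅ (X ⊗ A) ⊗ A]. It identifies [T ρ] with [ρ ⊗ A] by
    naturality, and the multiplication of [T] with that of [A] by
    [as_tensor_join]. *)
Lemma module_algebraP X (ρ : hom (X ⊗ A) X) :
  monad_algebra (ρ ∘ φ X) <->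
  ρ ∘ (ρ ⊗₁ idm A) = ρ ∘ (idm X ⊗₁ tmul) ∘ massoc X A A /\
  ρ ∘ (idm X ⊗₁ ret T 𝟙) = mrunit X.
Proof.
have retE : ρ ∘ φ X ∘ ret T X = ρ ∘ (idm X ⊗₁ ret T 𝟙) ∘ bwd (mrunit X).
  by rewrite -comp_assoc as_tensor_ret comp_assoc.
pose χ := iso_comp (φ (X ⊗ A)) (fmap_iso T (φ X)).
have mapE : ρ ∘ φ X ∘ fmap T (ρ ∘ φ X) = ρ ∘ (ρ ⊗₁ idm A) ∘ χ.
  by rewrite fmap_comp comp_assoc -(comp_assoc ρ) as_tensor_natural !comp_assoc.
have joinE : ρ ∘ φ X ∘ join T X = ρ ∘ (idm X ⊗₁ tmul) ∘ massoc X A A ∘ χ.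
  rewrite -comp_assoc as_tensor_join -[X in ρ ∘ X]comp_assoc -as_tensor_natural.
  by rewrite !comp_assoc.
split=> [[aη aT]|[ρA ρ1]]; split.
- by apply: (iso_cancel_r (f := χ)); rewrite -mapE -joinE.
- by rewrite -[LHS](comp_fwdK (mrunit X)) -retE aη comp_idl.
- by rewrite retE ρ1 bwdK.
- by rewrite mapE joinE ρA.
Qed.

Definition module_of (X : C) (a : hom (T X) X) := a ∘ bwd (φ X).

Lemma module_of_algebra X (a : hom (T X) X) (ρ := module_of a) :
  monad_algebra a ->
  ρ ∘ (ρ ⊗₁ idm A) = ρ ∘ (idm X ⊗₁ tmul) ∘ massoc X A A /\
  ρ ∘ (idm X ⊗₁ ret T 𝟙) = mrunit X.
Proof. by move=> a_alg; apply/module_algebraP; rewrite comp_fwdK. Qed.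

(** Precomposed with [as_tensor 𝟙], this is the unit law [join_fmap_ret] of the
    monad combined with [as_tensor_unit]. *)
Lemma tmul_unitl : tmul ∘ (ret T 𝟙 ⊗₁ idm A) = mlunit A.
Proof.
apply: (iso_cancel_r (f := φ 𝟙)).
rewrite -comp_assoc -as_tensor_natural comp_assoc comp_fwdK join_fmap_ret.
by rewrite as_tensor_unit.
Qed.

(** The remaining laws of [A] say that [A] is a right module over itself, and
    hold because [T 𝟙] is a free [T]-algebra. *)
Definition tensor_algebra : algebra C :=
  @Algebra k C A tmul (ret T 𝟙) (proj1 (module_of_algebra (free_algebra T 𝟙)))
    tmul_unitl (proj2 (module_of_algebra (free_algebra T 𝟙))).

Definition right_module_of X (a : hom (T X) X) (a_alg : monad_algebra a) :
    right_module tensor_algebra :=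
  @RightModule k C tensor_algebra X (module_of a)
    (proj1 (module_of_algebra a_alg)) (proj2 (module_of_algebra a_alg)).

Lemma rm_hom_algebra X (a : hom (T X) X) (N : right_module tensor_algebra)
    (f : hom X N) :
  f ∘ module_of a = rm_act N ∘ (f ⊗₁ idm A) <->
  f ∘ a = rm_act N ∘ φ N ∘ fmap T f.
Proof.
rewrite -[rm_act N ∘ _ ∘ _]comp_assoc as_tensor_natural.
rewrite [rm_act N ∘ (_ ∘ _)]comp_assoc.
have <- : f ∘ module_of a ∘ φ X = f ∘ a by rewrite -comp_assoc comp_fwdK.
by split=> [-> | /(iso_cancel_r (f := φ X))].
Qed.

End TensorMonad.

(** * The comparison functor *)

Section Comparison.
Variables (k : fieldType) (C : monoidal_category k) (D : abelian_category k).
Variables (L : functor C D) (R : functor D C) (adj : adjunction L R).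
Variable S : tensor_monad (adj_monad adj).
Local Notation A := (tensor_algebra S).
Local Notation ε := (adj_counit adj).

Definition comparison_ob (N : D) : right_module A :=
  right_module_of S (counit_algebra adj N).

Lemma comparison_mapP (N N' : D) (f : hom (R N) (R N')) :
  f ∘ rm_act (comparison_ob N) = rm_act (comparison_ob N') ∘ (f ⊗₁ idm (A : C))
  <-> f ∘ fmap R (ε N) = fmap R (ε N') ∘ fmap R (fmap L f).
Proof.
have := rm_hom_algebra (fmap R (ε N) : hom (adj_monad adj (R N)) _)
          (N := comparison_ob N') f.
by rewrite [rm_act _ ∘ _ in X in _ <-> X]comp_fwdK.
Qed.

Definition comparison : functor D (Mod A).
Proof.
unshelve refine (@Functor D (Mod A) comparison_ob
  (fun N N' g => exist _ (fmap R g) _) _ _).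
- apply/eqP/comparison_mapP.
  by rewrite -!fmap_comp adj_counit_natural.
- by move=> N; apply: val_inj; rewrite /= fmap_id.
- by move=> N N' N'' g f; apply: val_inj; rewrite /= fmap_comp.
Defined.

(** The forgetful functor of right modules reflects isomorphisms. *)
Definition rm_iso (X Y : right_module A) (θ : iso (X : C) (Y : C)) :
  θ ∘ rm_act X = rm_act Y ∘ (θ ⊗₁ idm (A : C)) -> iso (X : Mod A) (Y : Mod A).
Proof.
move=> θX.
have θY : bwd θ ∘ rm_act Y = rm_act X ∘ (bwd θ ⊗₁ idm (A : C)).
  apply: (iso_cancel_l (f := θ)).
  rewrite !comp_assoc bwdK comp_idl θX -comp_assoc -tens_compl bwdK bmap_id.
  by rewrite comp_idr.
exists (exist _ (fwd θ) (introT eqP θX)) (exist _ (bwd θ) (introT eqP θY)).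
- by apply: val_inj; rewrite /= fwdK.
- by apply: val_inj; rewrite /= bwdK.
Defined.

Lemma comparison_equivalence :
  is_additive R -> exact R -> faithful R -> equivalent D (Mod A).
Proof.
move=> R_additive R_exact R_faithful.
apply: (@fully_faithful_equivalent _ _ comparison).
- move=> N N' [f /= fP].
  have [|g gf] := algebra_map_lift R_additive R_faithful (f := f) (adj := adj).
    by apply/comparison_mapP/eqP.
  by exists g; apply: val_inj.
- by move=> N N' g h /(congr1 val); apply: R_faithful.
- move=> X.
  have a_alg : monad_algebra (rm_act X ∘ as_tensor S X).
    by apply/module_algebraP; split; [exact: rm_assoc | exact: rm_unit].
  have [Q [θ θa]] := algebra_of_object R_additive R_exact a_alg.
  exists Q; constructor; apply/iso_sym/(@rm_iso X (comparison_ob Q) θ).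
  have [_] := rm_hom_algebra (rm_act X ∘ as_tensor S X) (N := comparison_ob Q) θ.
  rewrite /module_of comp_bwdK; apply.
  by rewrite [rm_act (comparison_ob Q) ∘ _]comp_fwdK.
Qed.

End Comparison.

(** * The monad of an adjunction of module functors *)

Section ModuleAdjunction.
Variables (k : fieldType) (C : monoidal_category k).
Variables (tens_exact : biexact (@tens k C)) (M : module_category C).
Variables (Res : module_functor (regular_module tens_exact) M)
  (Ind : module_functor M (regular_module tens_exact)).
Variables (adj : adjunction Res Ind) (adj_module : module_adjunction adj).

Definition induction_monad : monad C := adj_monad adj.

Definition induction_str (X Y : C) :
    iso (induction_monad (X ⊗ Y)) (X ⊗ induction_monad Y) :=
  iso_comp (mf_iso Ind X (Res Y)) (fmap_iso Ind (mf_iso Res X Y)).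

Lemma induction_str_natural (X X' Y Y' : C) (f : hom X X') (g : hom Y Y') :
  induction_str X' Y' ∘ fmap induction_monad (f ⊗₁ g)
  = (f ⊗₁ fmap induction_monad g) ∘ induction_str X Y.
Proof.
have IndN := mf_natural Ind f (fmap Res g).
have ResN := mf_natural Res f g.
rewrite /= in IndN ResN *.
by rewrite -comp_assoc -fmap_comp ResN fmap_comp !comp_assoc IndN.
Qed.

Lemma induction_str_assoc (X Y Z : C) :
  massoc X Y (induction_monad Z) ∘ induction_str (X ⊗ Y) Z
  = (idm X ⊗₁ induction_str Y Z) ∘ induction_str X (Y ⊗ Z)
    ∘ fmap induction_monad (massoc X Y Z).
Proof.
have IndA := mf_assoc Ind X Y (Res Z).
have ResA := congr1 (fun u => fmap Ind u) (mf_assoc Res X Y Z).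
rewrite /= in IndA ResA *.
rewrite !fmap_comp in ResA.
rewrite comp_assoc IndA -comp_assoc ResA tens_compr !comp_assoc.
do 2 congr (_ ∘ _).
rewrite -!comp_assoc; congr (_ ∘ _).
exact: (mf_natural Ind (idm X) (mf_iso Res Y Z : hom _ _)).
Qed.

Lemma induction_str_unit (X : C) :
  mlunit (induction_monad X) ∘ induction_str 𝟙 X
  = fmap induction_monad (mlunit X).
Proof.
have IndU := mf_unit Ind (Res X).
have ResU := mf_unit Res X.
rewrite /= in IndU ResU *.
by rewrite comp_assoc IndU -fmap_comp ResU.
Qed.

(** The multiplication of the monad is [Ind] of a counit, so this is the
    compatibility of the counit with the module structures, transported along
    [Ind]. *)
Lemma induction_str_join (X Y : C) :
  induction_str X Y ∘ join induction_monad (X ⊗ Y)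
  = (idm X ⊗₁ join induction_monad Y) ∘ induction_str X (induction_monad Y)
    ∘ fmap induction_monad (induction_str X Y).
Proof.
have counitX := adj_module.2 X (Res Y).
rewrite /= in counitX *.
rewrite -comp_assoc -fmap_comp -[in LHS]adj_counit_natural -counitX.
rewrite !fmap_comp !comp_assoc.
do 3 congr (_ ∘ _).
exact: (mf_natural Ind (idm X) (adj_counit adj (Res Y))).
Qed.

Definition induction_tensor_monad : tensor_monad induction_monad :=
  TensorMonad induction_str_natural induction_str_assoc induction_str_unit
    adj_module.1 induction_str_join.

End ModuleAdjunction.

Theorem theorem5p9 (k : closedFieldType) (C : monoidal_category k)
    (tens_exact : biexact (@tens k C)) (M : module_category C)
    (Res : module_functor (regular_module tens_exact) M)
    (Ind : module_functor M (regular_module tens_exact))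
    (adj : adjunction Res Ind) (adj_module : module_adjunction adj)
    (Ind_exact : exact Ind) (Ind_faithful : faithful Ind) :
  exists A : algebra C, equivalent M (Mod A).
Proof.
exists (tensor_algebra (induction_tensor_monad adj_module)).
exact: (comparison_equivalence _ (mf_additive Ind) Ind_exact Ind_faithful).
Qed.
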